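(* Let $n$ be a positive integer. Let $x\ge 0$, $R>0$, $\overline{y}>0$, and let $u$ be a strictly increasing, strictly concave, continuously differentiable real-valued function on an interval containing $[0,x]\cup[0,Rx+\overline{y}]$. Assume that $-u^{(1)}$ (restricted to $[0,Rx+\overline{y}]$) belongs to $U_{n,[0,Rx+\overline{y}]}\cap AP_{n,[0,Rx+\overline{y}]}$. Let $F$ and $G$ be (probability) distribution functions supported on $[0,\overline{y}]$. Then $G\succeq_{n+1,[0,Rx+\overline{y}]-BSD}F$ implies $\rho(F)\ge\rho(G)$.
   Context: Consumption-savings model: an agent with initial wealth $x$ chooses savings $s\in C(x):=[0,x]$; $R$ is the deterministic rate of return and the next-period income $y\in[0,\overline{y}]$ is random with distribution function $F$. The agent's expected utility is $$w(s,F):=u(x-s)+\int_0^{\overline{y}}u(Rs+y)\,dF(y),$$ and $\rho(F):=\operatorname{argmax}_{s\in C(x)}w(s,F)$ denotes the (unique, by strict concavity) optimal savings. Integrals are over closed intervals, including possible atoms at the endpoints. $C^{m}([a,b])$ is the set of $m$ times continuously differentiable functions $v:[a,b]\to\mathbb{R}$ (one-sided derivatives at the endpoints); $v^{(k)}$ is the $k$-th derivative. For a positive integer $n$ and $a<b$: $$U_{n,[a,b]} := \{v \in C^{n+1}([a,b]) : (-1)^{k}v^{(k)}(z) \le 0 \ \ \forall z\in[a,b],\ \forall k=1,\dots,n+1\},$$ $$AP_{n,[a,b]} := \{v\in C^2([a,b]) : v^{(1)}(z)\ge 0,\ v^{(2)}(z)\le 0,\ (n-1)v^{(1)}(z)+v^{(2)}(z)(b-z)\le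 0\ \ \forall z\in[a,b]\}.$$ For distribution functions $F,G$ on $[a,b]$, $G \succeq_{n+1,[a,b]-BSD} F$ means $\int_a^b \max\{c-z,0\}^n\,dF(z) \ge \int_a^b \max\{c-z,0\}^n\,dG(z)$ for all $c\in[a,b]$. *)

(* Defs.v *)
From mathcomp Require Import all_boot all_order all_algebra.
From mathcomp Require Import all_classical all_reals all_analysis.
Import Order.TTheory GRing.Theory Num.Theory.
Import numFieldNormedType.Exports.

Set Implicit Arguments.
Unset Strict Implicit.
Unset Printing Implicit Defensive.

Local Open Scope classical_set_scope.
Local Open Scope ring_scope.

(* Derivatives are taken relative to a set [A]: difference quotients only use
   points of [A], so on an interval this is the usual derivative at interior
   points and the one-sided derivative at endpoints belonging to [A].  The value
   of [deriv_in A f z] is meaningful only for [z] in [A] with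
   [derivable_in A f z], and only depends on the restriction of [f] to [A]. *)
Section RelativeDerivatives.
Variable R : realType.
Implicit Types (A : set R) (f v : R -> R) (z : R) (m k : nat).

Definition derivable_in A f z : Prop :=
  cvg ((f y - f z) / (y - z) @[y --> within A z^']).

Definition deriv_in A f z : R :=
  lim ((f y - f z) / (y - z) @[y --> within A z^']).

Definition deriv_in_n A k f : R -> R := iter k (deriv_in A) f.

Definition Ck_in m A v : Prop :=
  (forall k, (k < m)%N -> forall z, A z -> derivable_in A (deriv_in_n A k v) z)
  /\ {within A, continuous (deriv_in_n A m v)}.

End RelativeDerivatives.

Section FunctionClasses.
Variable R : realType.
Implicit Types (a b : R) (n : nat).

Definition U_class n a b : set (R -> R) := [set v |
  Ck_in n.+1 `[a, b] v /\
  forall z, z \in `[a, b] -> forall k, (1 <= k <= n.+1)%N ->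
    (-1) ^+ k * deriv_in_n `[a, b] k v z <= 0].

Definition AP_class n a b : set (R -> R) := [set v |
  Ck_in 2 `[a, b] v /\
  forall z, z \in `[a, b] ->
    [/\ 0 <= deriv_in_n `[a, b] 1 v z,
        deriv_in_n `[a, b] 2 v z <= 0 &
        (n%:R - 1) * deriv_in_n `[a, b] 1 v z
          + deriv_in_n `[a, b] 2 v z * (b - z) <= 0]].

Definition strictly_increasing_on (A : set R) (f : R -> R) : Prop :=
  forall p q, A p -> A q -> p < q -> f p < f q.

Definition strictly_concave_on (A : set R) (f : R -> R) : Prop :=
  forall p q t, A p -> A q -> p != q -> 0 < t < 1 ->
    t * f p + (1 - t) * f q < f (t * p + (1 - t) * q).

End FunctionClasses.

(* A distribution function is a nondecreasing right-continuous function with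
   limits 0 at -oo and 1 at +oo; integrals against it are integrals for its
   Lebesgue-Stieltjes measure, over closed intervals, so that an atom at the
   left endpoint is counted. *)
Section Distributions.
Variable R : realType.
Implicit Types (a b : R) (F G : cumulativeBounded (0 : R) (1 : R)).

Definition supported_on a b F : Prop :=
  (forall z, z < a -> F z = 0) /\ (forall z, b <= z -> F z = 1).

Definition dist_int F a b (f : R -> R) : R :=
  Rintegral (lebesgue_stieltjes_measure F) `[a, b] f.

(* [BSD m a b G F]: G dominates F in the order of degree m on [a, b]; the
   exponent is m - 1. *)
Definition BSD (m : nat) a b G F : Prop :=
  forall c, c \in `[a, b] ->
    dist_int F a b (fun z => Num.max (c - z) 0 ^+ m.-1)
    >= dist_int G a b (fun z => Num.max (c - z) 0 ^+ m.-1).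

End Distributions.

Section Savings.
Variable R : realType.
Implicit Types (u : R -> R) (x r ybar s : R).
Implicit Types (F : cumulativeBounded (0 : R) (1 : R)).

Definition exp_utility u x r ybar F s : R :=
  u (x - s) + dist_int F 0 ybar (fun y => u (r * s + y)).

Definition argmax (C : set R) (f : R -> R) : set R :=
  [set s | C s /\ forall t, C t -> f t <= f s].

(* [xget] selects the element of the argmax, which is a singleton for strictly
   concave [u]; the 0 is only the value for an empty argmax. *)
Definition opt_savings u x r ybar F : R :=
  xget 0 (argmax `[0, x] (exp_utility u x r ybar F)).

End Savings.

(* Main.v *)
(** Write [h = - u'] and [p_j = (-1)^(j+1) h^(j)] on [0, b], [b = r x + ybar], so
    that [p_0 = u'], [p_j' = - p_(j+1)] and [p_j >= 0] for [1 <= j <= n+1].  The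
    AP condition reads [(n-1) p_1 <= (b - z) p_2]; comparing Taylor expansions at
    [b], it forces [p_j b = 0] for [0 < j < n].  Hence in the Taylor expansion of
    [p_0] at [b] only the constant, the term in [(b - z)^n] and the integral
    remainder survive, and [p_0 - p_0 b] is a uniform limit of nonnegative
    combinations of ramp powers [max (c - z) 0 ^ n] with [c] in [0, b].  Composing
    with [y |-> r s + y] moves the kink to [c - r s], and a ramp with a negative
    kink vanishes on [0, ybar], so by the BSD hypothesis expected marginal future
    utility is larger under F than under G.  Hence expected utility has increasing
    differences in savings and (F, G), and since the maximizer under F is unique
    it is at least the one under G. *)
Require Import Defs.
From mathcomp Require Import all_boot all_order all_algebra.
From mathcomp Require Import all_classical all_reals all_analysis.
From mathcomp Require Import ring lra.
Import Order.TTheory GRing.Theory Num.Theory.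
Import numFieldNormedType.Exports.

Set Implicit Arguments.
Unset Strict Implicit.
Unset Printing Implicit Defensive.

Local Open Scope classical_set_scope.
Local Open Scope ring_scope.

(** * Convex functions and cones of ramp powers *)

(** Over N equal steps of length d the errors telescope to [d * (m b - m a)], which tends to 0 as N
    grows. This sums bounds on short increments without differentiating [K]. *)
Lemma almost_ndecr (R : realType) (a b : R) (K m : R -> R) : a <= b ->
  (forall s t, a <= s -> s <= t -> t <= b ->
     (t - s) * (m s - m t) <= K t - K s) ->
  K a <= K b.
Proof.
move=> ab H; rewrite leNgt; apply/negP => Kba.
(* Enough steps for the total error to stay below the supposed drop [K a - K b]. *)
pose N := (Num.bound `|(b - a) * (m b - m a) / (K a - K b)|).+1.
have N0 : 0 < N%:R :> R by rewrite ltr0n.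
have HN : (b - a) * (m b - m a) / (K a - K b) < N%:R.
  apply: (le_lt_trans (ler_norm _)).
  by apply: (lt_trans (archi_boundP (normr_ge0 _))); rewrite ltr_nat.
pose d := (b - a) / N%:R.
have d0 : 0 <= d by rewrite divr_ge0 ?subr_ge0// ltW.
have step i : (i <= N)%N ->
    d * (m a - m (a + i%:R * d)) <= K (a + i%:R * d) - K a.
  elim: i => [_|i IH iN]; first by rewrite mul0r addr0 !subrr mulr0.
  have /IH {}IH := ltnW iN.
  have e : a + i.+1%:R * d = a + i%:R * d + d by rewrite mulrSr mulrDl mul1r addrA.
  have id0 : 0 <= i%:R * d by rewrite mulr_ge0.
  have Nd : N%:R * d = b - a by rewrite /d mulrC divfK// gt_eqF.
  have iNd : i.+1%:R * d <= b - a by rewrite -Nd ler_wpM2r// ler_nat.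
  have := H (a + i%:R * d) (a + i.+1%:R * d); rewrite e.
  have -> : a + i%:R * d + d - (a + i%:R * d) = d by ring.
  move: iNd; rewrite mulrSr mulrDl mul1r => iNd.
  move=> H'; have {}H' := H' ltac:(lra) ltac:(lra) ltac:(lra).
  lra.
have := step N (leqnn N).
have -> : a + N%:R * d = b by rewrite /d mulrC divfK ?gt_eqF// addrC subrK.
move: HN; rewrite ltr_pdivrMr ?subr_gt0// => HN.
rewrite /d mulrAC ler_pdivrMr//; lra.
Qed.

(** [- q x] is a subgradient of [f] at every [x] of [a, b], as when [f] is
    convex with derivative [- q]. *)
Definition subgrad (R : realType) (a b : R) (f q : R -> R) : Prop :=
  forall x y, a <= x <= b -> a <= y <= b -> q x * (x - y) <= f y - f x.

Section Subgradients.
Variable R : realType.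
Implicit Types (a b : R) (f g q w : R -> R).

Lemma subgrad_nincr a b f q x y : subgrad a b f q ->
  a <= x -> x <= y -> y <= b -> q y <= q x.
Proof.
move=> H ax; rewrite le_eqVlt => /predU1P[->//|xy] yb.
have h1 := H x y ltac:(lra) ltac:(lra); have h2 := H y x ltac:(lra) ltac:(lra).
have : (q y - q x) * (y - x) <= 0 by lra.
by rewrite pmulr_lle0 ?subr_gt0// subr_le0.
Qed.

Lemma subgrad_sub a b a' b' f q : a <= a' -> b' <= b ->
  subgrad a b f q -> subgrad a' b' f q.
Proof. by move=> aa bb H x y xab yab; apply: H; lra. Qed.

Lemma subgradD a b f q g w : subgrad a b f q -> subgrad a b g w ->
  subgrad a b (fun z => f z + g z) (fun z => q z + w z).
Proof. by move=> H1 H2 x y ax ay; have := H1 _ _ ax ay; have := H2 _ _ ax ay; lra. Qed.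

Lemma subgradZ a b k f q : 0 <= k -> subgrad a b f q ->
  subgrad a b (fun z => k * f z) (fun z => k * q z).
Proof.
move=> k0 H x y ax ay; have := H _ _ ax ay.
by rewrite -mulrBr -mulrA; exact: ler_wpM2l.
Qed.

(** Integration backwards from b. The subgradients [q s] and [w t] show that [f - g] loses at most
    [(t - s) * (q s - q t)] on [s, t], so [almost_ndecr] applies with [m = - q]. *)
Lemma subgrad_le a b f g q w : subgrad a b f q -> subgrad a b g w ->
  f b <= g b -> (forall z, a <= z <= b -> q z <= w z) ->
  forall z, a <= z <= b -> f z <= g z.
Proof.
move=> Hf Hg fgb qw z /andP[az zb].
have : f z - g z <= f b - g b.
  apply: (@almost_ndecr R z b (fun z => f z - g z) (fun z => - q z) zb) => s t zs st tb.
  have := Hf s t ltac:(lra) ltac:(lra); have := Hg t s ltac:(lra) ltac:(lra).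
  have := ler_wpM2r (_ : 0 <= t - s) (qw t ltac:(lra)).
  by rewrite subr_ge0 => /(_ st); lra.
by lra.
Qed.

(** Convexity of the power, by induction: multiply the previous degree by x and add
    [(y - x) * (y ^+ k.+1 - x ^+ k.+1) >= 0]. *)
Lemma subrX_ge (x y : R) k : 0 <= x -> 0 <= y ->
  k.+1%:R * x ^+ k * (y - x) <= y ^+ k.+1 - x ^+ k.+1.
Proof.
move=> x0 y0; elim: k => [|k IH]; first by rewrite !expr1 expr0; lra.
have xk : 0 <= x ^+ k by exact: exprn_ge0.
have h1 := ler_wpM2l x0 IH.
have h2 : 0 <= (y - x) * (y ^+ k.+1 - x ^+ k.+1).
  have [xy|/ltW yx] := leP x y.
    by rewrite mulr_ge0// subr_ge0// lerXn2r// nnegrE.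
  by rewrite mulr_le0// subr_le0// lerXn2r// nnegrE.
have e : x ^+ k.+1 = x * x ^+ k by rewrite exprS.
rewrite (mulrSr 1 k.+1) (exprS y k.+1) (exprS x k.+1).
move: h1 h2; rewrite e; set X := x ^+ k; set Y := y ^+ k.+1; set c := k.+1%:R.
by move=> h1 h2; lra.
Qed.

(** The lower exponent starts at 1: a zeroth power would equal 1 also beyond the kink, where the
    ramp is flat. *)
Lemma subgrad_posX a b c k : subgrad a b
  (fun z => k.+2%:R^-1 * Num.max (c - z) 0 ^+ k.+2)
  (fun z => Num.max (c - z) 0 ^+ k.+1).
Proof.
move=> x y _ _; rewrite -mulrBr ler_pdivlMl ?ltr0n// mulrA.
have := @subrX_ge (Num.max (c - x) 0) (Num.max (c - y) 0) k.+1.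
rewrite !le_max !lexx !orbT => /(_ isT isT).
apply: le_trans.
have [cx|xc] := leP (c - x) 0; first by rewrite expr0n !mulr0 !mul0r.
apply: ler_wpM2l; first by rewrite mulr_ge0// exprn_ge0// ltW.
by have [|] := leP (c - y) 0; lra.
Qed.

Lemma subgrad_subX a b k : subgrad a b
  (fun z => (k.+1)`!%:R^-1 * (b - z) ^+ k.+1)
  (fun z => k`!%:R^-1 * (b - z) ^+ k).
Proof.
move=> x y /andP[_ xb] /andP[_ yb]; rewrite -mulrBr factS natrM invfM.
have := @subrX_ge (b - x) (b - y) k; rewrite !subr_ge0 => /(_ xb yb).
rewrite (_ : b - y - (b - x) = x - y); last by ring.
have k0 : 0 < k`!%:R^-1 :> R by rewrite invr_gt0 ltr0n fact_gt0.
have -> (D : R) : k.+1%:R^-1 * k`!%:R^-1 * D = k`!%:R^-1 * (k.+1%:R^-1 * D).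
  by rewrite -mulrA mulrCA.
by move=> H; rewrite -mulrA ler_pM2l// ler_pdivlMl ?ltr0n// mulrA.
Qed.


(** Integrate k times from b with [subgrad_le]; the Taylor terms of order below k are nonnegative
    and are dropped. *)
Lemma taylor_ge a b (p : nat -> R -> R) k :
  (forall j, (j < k)%N -> subgrad a b (p j) (p j.+1)) ->
  (forall j, (j <= k)%N -> 0 <= p j b) ->
  (forall z, a <= z <= b -> p k b <= p k z) ->
  forall z, a <= z <= b -> p k b * (k`!%:R^-1 * (b - z) ^+ k) <= p 0%N z.
Proof.
elim: k p => [|k IH] p Hp p0 pk.
  by move=> z zab; rewrite fact0 invr1 mul1r expr0 mulr1; exact: pk.
move=> z zab; have /= H := subgrad_le
  (subgradZ (p0 k.+1 (leqnn _)) (@subgrad_subX a b k)) (Hp 0%N isT).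
apply: H zab; first by rewrite subrr expr0n !mulr0 p0.
by apply: (IH (fun j => p j.+1)) => // j jk; [exact: Hp|exact: p0].
Qed.

(** The same integration, with vanishing lower terms and the top function bounded by its value at
    a. *)
Lemma taylor_le a b (p : nat -> R -> R) k :
  (forall j, (j < k)%N -> subgrad a b (p j) (p j.+1)) ->
  (forall j, (j < k)%N -> p j b = 0) ->
  (forall z, a <= z <= b -> 0 <= p k z <= p k a) ->
  forall z, a <= z <= b -> p 0%N z <= p k a * (k`!%:R^-1 * (b - z) ^+ k).
Proof.
elim: k p => [|k IH] p Hp p0 pk z zab.
  by rewrite fact0 invr1 mul1r expr0 mulr1; case/andP: (pk _ zab).
have pk0 : 0 <= p k.+1 a by case/andP: (pk _ zab) => /le_trans; apply.
have /= H := subgrad_le (Hp 0%N isT) (subgradZ pk0 (@subgrad_subX a b k)).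
apply: H zab; first by rewrite subrr expr0n !mulr0 p0.
by apply: (IH (fun j => p j.+1)) => // j jk; [exact: Hp|exact: p0].
Qed.

(* If [p j b] were the first nonzero value, then [p 0] and [p 1] would behave like
   [p j b * (b - z)^j / j!] and [p j b * (b - z)^(j-1) / (j-1)!] near [b], and the
   last hypothesis would give [m <= j]. *)
Lemma subgrad_flat_end a b (p : nat -> R -> R) m : a < b ->
  (forall j, (j < m)%N -> subgrad a b (p j) (p j.+1)) ->
  (forall j z, (j <= m)%N -> a <= z <= b -> 0 <= p j z) ->
  (forall z, a <= z <= b -> m%:R * p 0%N z <= (b - z) * p 1%N z) ->
  forall j, (j < m)%N -> p j b = 0.
Proof.
move=> ab Hp p0 Hm; elim/ltn_ind => -[_ m0|i IH im].
  have := Hm b ltac:(lra); rewrite subrr mul0r pmulr_rle0 ?ltr0n// => pb.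
  by apply/eqP; rewrite eq_le pb p0//; lra.
have bab : a <= b <= b by lra.
have pj0 z : a <= z <= b -> 0 <= p i.+1 z by apply: p0; exact: ltnW.
have pjn z y : a <= z -> z <= y -> y <= b -> p i.+1 y <= p i.+1 z.
  exact: (subgrad_nincr (Hp i (ltnW im))).
have pjb z : a <= z <= b -> p i.+1 b <= p i.+1 z by move=> ?; apply: pjn; lra.
(* Insert the lower Taylor bound for [p 0] and the upper one for [p 1], taken on [z, b], into the
   last hypothesis, and cancel [(b - z) ^+ i.+1 / (i.+1)!]. *)
have sharp z : a <= z < b -> m%:R * p i.+1 b <= i.+1%:R * p i.+1 z.
  move=> /andP[az zb].
  have lo := @taylor_ge a b p i.+1 (fun j ji => Hp j (ltn_trans ji im))
    (fun j ji => p0 j b (leq_trans ji (ltnW im)) bab)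
    pjb z ltac:(lra).
  have hi : p 1%N z <= p i.+1 z * (i`!%:R^-1 * (b - z) ^+ i).
    apply: (@taylor_le z b (fun j => p j.+1)).
    - by move=> j ji; apply: subgrad_sub (Hp j.+1 _) => //; exact: leq_ltn_trans (ltnW im).
    - by move=> j ji; apply: IH => //; exact: leq_ltn_trans (ltnW im).
    - by move=> y yab; rewrite pj0 ?pjn//=; lra.
    - by lra.
  have mid := Hm z ltac:(lra).
  have {}lo := ler_wpM2l (ler0n R m) lo.
  have bz : 0 < b - z by lra.
  have {}hi := ler_wpM2l (ltW bz) hi.
  have X0 : 0 < (i.+1)`!%:R^-1 * (b - z) ^+ i.+1.
    by rewrite mulr_gt0 ?exprn_gt0// invr_gt0 ltr0n fact_gt0.
  rewrite -(ler_pM2r X0) -mulrA; apply: (le_trans lo); apply: (le_trans mid).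
  apply: (le_trans hi); rewrite factS natrM invfM exprS le_eqVlt; apply/orP; left.
  apply/eqP; field.
  by rewrite nat1r !pnatr_eq0 -lt0n fact_gt0.
apply/eqP; rewrite eq_le pj0// andbT leNgt; apply/negP => P0.
(* As [i.+2 <= m], and [p i.+1 z] exceeds [p i.+1 b] by at most [p i.+2 a * (b - z)], [sharp] leaves
   [p i.+1 b <= D * (b - z)]. *)
pose D := i.+1%:R * p i.+2 a.
have D0 : 0 <= D by rewrite mulr_ge0// p0//; lra.
have key z : a <= z < b -> p i.+1 b <= D * (b - z).
  move=> zab; have h := sharp z zab.
  have lip := Hp i.+1 im z b ltac:(lra) ltac:(lra).
  have pz : p i.+2 z <= p i.+2 a by apply: (subgrad_nincr (Hp _ im)); lra.
  have h1 : p i.+1 z <= p i.+1 b + p i.+2 a * (b - z).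
    have : p i.+2 z * (b - z) <= p i.+2 a * (b - z) by rewrite ler_wpM2r//; lra.
    by lra.
  have h2 := ler_wpM2l (ler0n R i.+1) h1.
  have h3 : (i.+1%:R + 1) * p i.+1 b <= m%:R * p i.+1 b.
    by rewrite ler_wpM2r// ?pj0// natr1 ler_nat.
  rewrite /D; lra.
(* At distance [e] from b the bound [D * e] is less than [p i.+1 b], against [key]. *)
pose e := Num.min (b - a) (p i.+1 b / (2 * (D + 1))).
have e0 : 0 < e by rewrite lt_min subr_gt0 ab divr_gt0//; lra.
have eb : e <= b - a by rewrite ge_min lexx.
have eP : e * (2 * (D + 1)) <= p i.+1 b.
  by rewrite -ler_pdivlMr; [rewrite ge_min lexx orbT|lra].
have := key (b - e) ltac:(lra); lra.
Qed.

(** * Ramp powers and their uniform limits *)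

Definition comb k (s : seq (R * R)) z : R :=
  \sum_(t <- s) t.1 * Num.max (t.2 - z) 0 ^+ k.

Definition admissible a b (s : seq (R * R)) : bool :=
  all (fun t => (0 <= t.1) && (a <= t.2 <= b)) s.

(* Uniform closure of the nonnegative combinations of ramp powers with kinks in
   [a, b]. *)
Definition ramp_cone k a b v : Prop := forall e, 0 < e -> exists2 s,
  admissible a b s & forall z, a <= z <= b -> `|v z - comb k s z| <= e.

Lemma subgrad_comb a b k s : admissible a b s ->
  subgrad a b (comb k.+2 [seq (k.+2%:R^-1 * t.1, t.2) | t <- s]) (comb k.+1 s).
Proof.
elim: s => [_|t s IH /andP[/andP[t0 _] hs]] x y xab yab.
  by rewrite /comb !big_nil subrr mul0r.
rewrite /comb /= !big_cons.
have := IH hs x y xab yab; have /= := subgradZ t0 (@subgrad_posX a b t.2 k) xab yab.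
rewrite /comb !big_map /=.
set S0 := (\sum_(_ <- s) _); set S1 := (\sum_(_ <- s) _); set S2 := (\sum_(_ <- s) _).
set c := _^-1; set X := _ ^+ k.+1; set Y := _ ^+ k.+2; set Z := _ ^+ k.+2; lra.
Qed.

(** Integrating an approximation of [w] term by term keeps the kinks and divides the weights by
    [k.+2]. A uniform error d for [w] becomes at most [d * (b - z)] for [v], as both functions
    vanish at b. *)
Lemma ramp_cone_int a b k v w : a <= b -> ramp_cone k.+1 a b w ->
  subgrad a b v w -> v b = 0 -> ramp_cone k.+2 a b v.
Proof.
move=> ab Hw vw vb e e0.
have ba1 : 0 < b - a + 1 by lra.
(* The added 1 keeps the denominator positive when a = b. *)
have [s hs ws] := Hw (e / (b - a + 1)) (divr_gt0 e0 ba1).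
set d := e / _ in ws; exists [seq (k.+2%:R^-1 * t.1, t.2) | t <- s].
  rewrite /admissible all_map; apply: sub_all hs => t /= /andP[t0 ->].
  by rewrite mulr_ge0// invr_ge0.
set s' := map _ _ => z zab.
have d0 : 0 <= d by exact/ltW/divr_gt0.
have lin : subgrad a b (fun z => d * (b - z)) (fun=> d).
  by move=> x y _ _; lra.
have s'b : comb k.+2 s' b = 0.
  rewrite /comb big_seq big1// => t /mapP[t' t's ->] /=.
  move/allP: hs => /(_ _ t's) /andP[_ /andP[_ tb]].
  by rewrite (max_idPr _) ?subr_le0// expr0n mulr0.
have ss' := subgrad_comb k hs; rewrite -/s' in ss'.
have dz : d * (b - z) <= e.
  rewrite /d mulrAC ler_pdivrMr// ler_pM2l//; lra.
have h1 := subgrad_le vw (subgradD ss' lin) _ _ zab.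
have h2 := subgrad_le ss' (subgradD vw lin) _ _ zab.
rewrite ler_norml; apply/andP; split.
  rewrite /= in h2; suff : comb k.+2 s' z <= v z + d * (b - z) by lra.
  apply: h2; first by rewrite s'b vb subrr; lra.
  by move=> y yab; have := ws y yab; rewrite ler_norml; lra.
suff : v z <= comb k.+2 s' z + d * (b - z) by lra.
apply: h1; first by rewrite s'b vb subrr; lra.
by move=> y yab; have := ws y yab; rewrite ler_norml; lra.
Qed.

(** A nonincreasing convex function vanishing at b is nearly piecewise linear: the drops of [q]
    along a grid are the weights of the ramps, and [q b] is the weight of the ramp at b. *)
Lemma ramp_cone1 a b v q : a < b -> subgrad a b v q ->
  0 <= q b -> v b = 0 -> ramp_cone 1 a b v.
Proof.
move=> ab vq qb vb e e0.
pose N := (Num.bound `|(b - a) * (q a - q b) / e|).+1.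
have N0 : 0 < N%:R :> R by rewrite ltr0n.
pose d := (b - a) / N%:R.
have d0 : 0 < d by rewrite divr_gt0// subr_gt0.
have Nd : N%:R * d = b - a by rewrite /d mulrC divfK// gt_eqF.
have dq : d * (q a - q b) <= e.
  rewrite /d mulrAC ler_pdivrMr// [leRHS]mulrC -ler_pdivrMr//; apply: ltW.
  apply: (le_lt_trans (ler_norm _)).
  by apply: (lt_trans (archi_boundP (normr_ge0 _))); rewrite ltr_nat.
pose c i : R := a + i%:R * d.
have cS i : c i.+1 = c i + d by rewrite /c mulrSr mulrDl mul1r addrA.
have cN : c N = b by rewrite /c Nd addrC subrK.
have ca i : a <= c i by rewrite lerDl mulr_ge0// ltW.
have cb i : (i <= N)%N -> c i <= b.
  by move=> iN; rewrite -lerBrDl -Nd ler_pM2r// ler_nat.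
(* [T i] is [v] minus its tangent line at [c i], cut off to the right of [c i];
   passing from [c i] to [c i.+1] adds a multiple of the ramp at [c i], up to
   an error of [(q (c i) - q (c i.+1)) * d]. *)
pose T i z := if z <= c i then v z - v (c i) - q (c i) * (c i - z) else 0.
(* The errors telescope to [(q a - q (c i)) * d], which the choice of [N] keeps below e. *)
have step i : (i <= N)%N -> exists2 s, admissible a b s &
    forall z, a <= z <= b -> 0 <= T i z - comb 1 s z <= (q a - q (c i)) * d.
  elim: i => [_|i IH iN].
    exists [::] => // z zab; rewrite /comb big_nil /T /c mul0r addr0 subr0 subrr mul0r.
    case: (leP z a) => [za|]; last by rewrite lexx.
    have -> : z = a by apply: le_anti; lra.
    by rewrite !subrr mulr0 subrr lexx.
  have [s hs Hs] := IH (ltnW iN).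
  have cib := cb _ (ltnW iN); have ciSb := cb _ iN; have cia := ca i.
  have ciS := cS i.
  have qq : q (c i.+1) <= q (c i) by apply: (subgrad_nincr vq) => //; lra.
  exists ((q (c i) - q (c i.+1), c i) :: s).
    by rewrite /= hs subr_ge0 qq cib cia.
  move=> z zab; rewrite /comb big_cons /= -/(comb 1 s z) expr1.
  have := Hs z zab.
  have h1 := vq (c i) (c i.+1) ltac:(lra) ltac:(lra).
  have h2 := vq (c i.+1) (c i) ltac:(lra) ltac:(lra).
  have h3 := vq (c i.+1) z ltac:(lra) ltac:(lra).
  have h4 := vq z (c i.+1) ltac:(lra) ltac:(lra).
  rewrite /T; case: (leP z (c i)) => zi.
    have -> : z <= c i.+1 by lra.
    rewrite (max_idPl _) ?subr_ge0//.
    move: h1 h2; rewrite ciS; lra.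
  rewrite (max_idPr _); last by lra.
  have qz : q z <= q (c i) by apply: (subgrad_nincr vq); lra.
  have qz' : 0 <= q (c i) - q (c i.+1) by lra.
  case: (leP z (c i.+1)) => zi1; last by have := mulr_ge0 qz' (ltW d0); lra.
  have : (q z - q (c i.+1)) * (c i.+1 - z) <= (q (c i) - q (c i.+1)) * d.
    have qz1 : q (c i.+1) <= q z by apply: (subgrad_nincr vq); lra.
    by apply: ler_pM; lra.
  lra.
have [s hs Hs] := step N (leqnn N).
(* [T N] is [v] minus its tangent at b; the ramp at b with weight [q b] restores that tangent
   because [v b = 0]. *)
exists ((q b, b) :: s); first by rewrite /= hs qb lexx ltW.
move=> z zab; rewrite /comb big_cons /= -/(comb 1 s z) expr1.
have := Hs z zab; rewrite /T cN; have -> : z <= b by lra.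
rewrite vb subr0 (max_idPl _) ?subr_ge0; last by lra.
move=> hz; rewrite ler_norml; lra.
Qed.

(** Induction on n: [p 1] vanishes at b, so the induction hypothesis puts [p 1] itself in the cone
    of one degree less, and [ramp_cone_int] raises the degree. For n = 1 only convexity of [p 0] is
    used. *)
Lemma ramp_cone_family a b (p : nat -> R -> R) n : a < b ->
  (forall j, (j < n)%N -> subgrad a b (p j) (p j.+1)) ->
  (forall j, (0 < j < n)%N -> p j b = 0) -> 0 <= p n b -> (0 < n)%N ->
  ramp_cone n a b (fun z => p 0%N z - p 0%N b).
Proof.
move=> ab; case: n => // n; elim: n p => [|n IH] p Hp pb pn _.
  apply: (@ramp_cone1 _ _ _ (p 1%N)) => //; last by rewrite subrr.
  by move=> x y xab yab; have := Hp 0%N isT x y xab yab; lra.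
apply: (@ramp_cone_int _ _ _ _ (p 1%N)); [exact: ltW| | |by rewrite subrr].
  have pb' j : (0 < j < n.+1)%N -> p j.+1 b = 0 by case/andP=> _ jn; exact: pb.
  move=> e e0; have [s hs Hs] := IH _ (fun j jn => Hp j.+1 jn) pb' pn isT e e0.
  by exists s => // z /Hs; rewrite (pb 1%N)// subr0.
by move=> x y xab yab; have := Hp 0%N isT x y xab yab; lra.
Qed.

End Subgradients.

(** * Derivatives relative to a set *)

Section RelativeDerivative.
Variable R : realType.
Implicit Types (A : set R) (f q : R -> R) (a b z : R).

Lemma derivable_in_cvg A f z : derivable_in A f z ->
  f y @[y --> within A (nbhs z)] --> f z.
Proof.
move=> dz; rewrite /derivable_in in dz.
set Q := fun y : R => (f y - f z) / (y - z) in dz.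
(* Off z this expression is [f y]; the point z, missing from the punctured filter, is treated apart
   at the end. *)
have h1 : f z + Q y * (y - z) @[y --> within A z^'] -->
    f z + lim (Q y @[y --> within A z^']) * (z - z).
  apply: cvgD; first exact: cvg_cst.
  apply: cvgM; first exact: dz.
  apply: cvgB; last exact: cvg_cst.
  by apply: cvg_within_filter; exact: cvg_within_filter.
rewrite subrr mulr0 addr0 in h1.
move=> P Pz.
have h2 : nbhs z [set y | y != z -> A y -> P (f z + Q y * (y - z))] := h1 P Pz.
change (nbhs z [set y | A y -> P (f y)]).
have Pfz := nbhs_singleton Pz.
apply: filterS h2 => y hy Ay.
have [->//|yz] := eqVneq y z.
have := hy yz Ay; rewrite /= /Q divfK ?subr_eq0// addrC subrK//.
Qed.

Lemma derivable_in_continuous A f : (forall z, A z -> derivable_in A f z) ->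
  {within A, continuous f}.
Proof.
by move=> H; apply/subspace_continuousP => z Az; exact/derivable_in_cvg/H.
Qed.

Lemma within_dnbhs A z : nbhs z A -> within A z^' = z^'.
Proof.
move=> Az; rewrite eqEsubset; split=> P.
  move=> h; have {}h : nbhs z [set y | y != z -> A y -> P y] := h.
  change (nbhs z [set y | y != z -> P y]).
  by apply: filterS2 Az h => y Ay h yz; exact: h.
move=> h; have {}h : nbhs z [set y | y != z -> P y] := h.
change (nbhs z [set y | y != z -> A y -> P y]).
by apply: filterS h => y h yz _; exact: h.
Qed.

Lemma dnbhs_shift (g : R -> R) z : g (h + z) @[h --> 0^'] = g y @[y --> z^'].
Proof.
rewrite eqEsubset; split=> P h.
  have {}h : \forall y \near 0, y != 0 -> P (g (y + z)) := h.
  change (\forall y \near z, y != z -> P (g y)).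
  rewrite (near_shift 0 z) subr0; apply: filterS h => y /= h yz.
  by apply: h; apply: contra_neq yz => ->; rewrite add0r.
have {}h : \forall y \near z, y != z -> P (g y) := h.
change (\forall y \near 0, y != 0 -> P (g (y + z))).
rewrite (near_shift z 0) sub0r; apply: filterS h => y /= h yz.
by rewrite subrK; apply: h; apply: contra_neq yz => ->; rewrite subrr.
Qed.

Lemma derivable_in_is_derive A f z : nbhs z A -> derivable_in A f z ->
  is_derive z 1 f (deriv_in A f z).
Proof.
move=> Az; rewrite /derivable_in /deriv_in (within_dnbhs Az).
pose q y := (f y - f z) / (y - z).
pose g (h : R) := h^-1 *: ((f \o shift z) (h *: 1) - f z).
have qg : q \o shift z = g.
  by apply/funext => h; rewrite /q /g /= addrK /GRing.scale/= mulr1 mulrC.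
have E : q y @[y --> z^'] = g h @[h --> 0^'] by rewrite -qg -dnbhs_shift.
by rewrite -/q E => h; exact: DeriveDef.
Qed.

(** At interior points the relative derivative is the ordinary one; at the endpoints the mean value
    theorem asks only for continuity. *)
Lemma derivable_in_MVT A f a b x y : `[a, b] `<=` A ->
  (forall z, a <= z <= b -> derivable_in A f z) ->
  a <= x -> x < y -> y <= b ->
  exists2 z, x < z < y & f y - f x = deriv_in A f z * (y - x).
Proof.
move=> abA df ax xy yb.
have dfz z : z \in `]x, y[ -> is_derive z 1 f (deriv_in A f z).
  rewrite in_itv/= => zxy; apply: derivable_in_is_derive; last by apply: df; lra.
  have zab : z \in `]a, b[ by rewrite in_itv/=; lra.
  apply: filterS (near_in_itvoo zab) => w; rewrite in_itv/= => wab.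
  by apply: abA; rewrite /= in_itv/=; lra.
have cf : {within `[x, y], continuous f}.
  have xyA : `[x, y] `<=` A.
    by move=> w; rewrite /= in_itv/= => wxy; apply: abA; rewrite /= in_itv/=; lra.
  apply/subspace_continuousP => z; rewrite /= in_itv/= => zxy.
  have := derivable_in_cvg (df z ltac:(lra)); apply: cvg_trans.
  by apply: cvg_app; apply: within_subset.
have [z zxy e] := MVT xy dfz cf.
by exists z; first by rewrite in_itv in zxy.
Qed.

(** The factor [c] stands for the alternating sign of the successive derivatives. *)
Lemma derivable_in_nincr A c f a b : `[a, b] `<=` A ->
  (forall z, a <= z <= b -> derivable_in A f z) ->
  (forall z, a <= z <= b -> c * deriv_in A f z <= 0) ->
  forall x y, a <= x -> x <= y -> y <= b -> c * f y <= c * f x.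
Proof.
move=> abA df f0 x y ax; rewrite le_eqVlt => /predU1P[->//|xy] yb.
have [z zxy e] := derivable_in_MVT abA df ax xy yb.
by rewrite -subr_le0 -mulrBr e mulrA mulr_le0_ge0// ?f0// ?subr_ge0//; lra.
Qed.

(** The mean value theorem gives the increment through [q] at an intermediate point, which
    monotonicity compares with [q x]. *)
Lemma subgrad_derivable_in A c f q a b : `[a, b] `<=` A ->
  (forall z, a <= z <= b -> derivable_in A f z) ->
  (forall z, a <= z <= b -> c * deriv_in A f z = - q z) ->
  (forall x y, a <= x -> x <= y -> y <= b -> q y <= q x) ->
  subgrad a b (fun z => c * f z) q.
Proof.
move=> abA df fq qn x y xab yab; rewrite -mulrBr.
case: (ltgtP x y) => [xy|yx|->]; last by rewrite !subrr !mulr0.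
  have [z zxy ->] := derivable_in_MVT abA df (proj1 (andP xab)) xy (proj2 (andP yab)).
  rewrite mulrA fq; last by lra.
  have : q z <= q x by apply: qn; lra.
  by rewrite -subr_ge0 => /(mulr_ge0 (_ : 0 <= y - x)); rewrite subr_ge0 ltW// => /(_ isT); lra.
have [z zxy e] := derivable_in_MVT abA df (proj1 (andP yab)) yx (proj2 (andP xab)).
have qxz : q x <= q z by apply: qn; lra.
have := ler_wpM2r (_ : 0 <= x - y) qxz; rewrite subr_ge0 (ltW yx) => /(_ isT).
by rewrite -(opprB (f x)) e mulrN mulrA fq; lra.
Qed.

End RelativeDerivative.

(** * Integrals against a distribution function *)

Section DistInt.
Variable R : realType.
Implicit Types (F : cumulativeBounded (0 : R) (1 : R)) (a b c : R) (f g : R -> R).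

Lemma dist_integrable F a b f : {within `[a, b], continuous f} ->
  (lebesgue_stieltjes_measure F).-integrable `[a, b] (EFin \o f).
Proof.
move=> cf; apply: measurable_bounded_integrable.
- exact: measurable_itv.
- apply: (le_lt_trans (probability_le1 _ _)); first exact: measurable_itv.
  exact: ltry.
- by apply: measurable_realfun.subspace_continuous_measurable_fun => //; exact: measurable_itv.
- have /compact_bounded[M [_ mrt]] := continuous_compact cf (@segment_compact _ a b).
  by exists M; split; rewrite ?num_real // => ? ? ? ?; exact: mrt.
Qed.

Lemma dist_intD F a b f g : {within `[a, b], continuous f} ->
  {within `[a, b], continuous g} ->
  dist_int F a b (fun z => f z + g z) = dist_int F a b f + dist_int F a b g.
Proof. by move=> cf cg; apply: RintegralD => //; exact: dist_integrable. Qed.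

Lemma dist_intZ F a b c f : {within `[a, b], continuous f} ->
  dist_int F a b (fun z => c * f z) = c * dist_int F a b f.
Proof. by move=> cf; apply: RintegralZl => //; exact: dist_integrable. Qed.

Lemma le_dist_int F a b f g : {within `[a, b], continuous f} ->
  {within `[a, b], continuous g} -> (forall z, a <= z <= b -> f z <= g z) ->
  dist_int F a b f <= dist_int F a b g.
Proof.
move=> cf cg fg; apply: le_Rintegral; [by []|exact: dist_integrable..|].
by move=> z; rewrite /= in_itv/=; exact: fg.
Qed.

Lemma eq_dist_int F a b f g : (forall z, a <= z <= b -> f z = g z) ->
  dist_int F a b f = dist_int F a b g.
Proof.
move=> fg; apply: eq_Rintegral => z; rewrite inE /= in_itv/=; exact: fg.
Qed.

Lemma lebesgue_stieltjes_itv_oc F a b : a <= b ->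
  lebesgue_stieltjes_measure F `]a, b] = (F b - F a)%:E.
Proof.
move=> ab; rewrite /lebesgue_stieltjes_measure /measure_extension.
rewrite measurable_mu_extE/=; last exact: is_ocitv.
by rewrite wlength_itv_bnd// EFinB.
Qed.

(** [0, b] is the decreasing intersection of the intervals ]-1/(n+1), b], all of mass 1, so an atom
    at 0 is counted. *)
Lemma supported_measure F b : 0 <= b -> supported_on 0 b F ->
  lebesgue_stieltjes_measure F `[0, b] = 1%E.
Proof.
move=> b0 [F0 F1].
pose I n : set R := `]- n.+1%:R^-1, b]%classic.
have neg n : - n.+1%:R^-1 < 0 :> R by rewrite oppr_lt0 invr_gt0.
have I1 n : lebesgue_stieltjes_measure F (I n) = 1%E.
  rewrite lebesgue_stieltjes_itv_oc; last exact: (le_trans (ltW (neg n))).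
  by rewrite (F1 b)// (F0 _ (neg n)) subr0.
have -> : `[0, b]%classic = \bigcap_n I n.
  rewrite eqEsubset; split=> z /=.
    by rewrite in_itv/= => /andP[z0 zb] n _; rewrite /I/= in_itv/= zb (lt_le_trans (neg n)).
  move=> h; rewrite in_itv/=; have := h 0%N Logic.I; rewrite /I/= in_itv/= => /andP[_ ->].
  rewrite andbT leNgt; apply/negP => z0.
  have nz : 0 < - z by rewrite oppr_gt0.
  have [n hn] := filter_ex (near_infty_natSinv_lt (PosNum nz)).
  have := h n Logic.I; rewrite /I/= in_itv/= => /andP[+ _].
  by rewrite ltrNl ltNge (ltW hn).
have : (lebesgue_stieltjes_measure F \o I) n @[n --> \oo] -->
    lebesgue_stieltjes_measure F (\bigcap_n I n).
  apply: nonincreasing_cvg_mu.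
  - by rewrite [X in (X < _)%E](I1 0%N) ltry.
  - by move=> n; exact: measurable_itv.
  - by apply: bigcap_measurable => // n _; exact: measurable_itv.
  - move=> m n mn; apply/subsetPset/subset_itv; rewrite leBSide//=.
    by rewrite lerN2 lef_pV2 ?posrE// ler_nat.
rewrite (_ : _ \o I = cst 1%E); last by apply/funext => n; exact: I1.
move=> h; have := cvg_unique _ h (@cvg_cst _ _ _ _ _); exact.
Qed.

Lemma dist_int_cst F b c : 0 <= b -> supported_on 0 b F -> dist_int F 0 b (fun=> c) = c.
Proof.
by move=> b0 Fs; rewrite /dist_int Rintegral_cst//= supported_measure// mulr1.
Qed.

(** The added piece ]b, c] is null, as [F] equals 1 from b on. *)
Lemma dist_int_widen F b c f : 0 <= b -> b <= c -> supported_on 0 b F ->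
  {within `[0, c], continuous f} -> dist_int F 0 c f = dist_int F 0 b f.
Proof.
move=> b0 bc [_ F1] cf; rewrite /dist_int /Rintegral; congr (fine _).
have null : lebesgue_stieltjes_measure F `]b, c] = 0%E.
  by rewrite lebesgue_stieltjes_itv_oc// !F1// subrr.
rewrite [LHS](negligible_integral _ _ (dist_integrable F cf) null);
  [|exact: measurable_itv..].
congr (integral _ _ _).
rewrite eqEsubset; split=> z; rewrite /= !in_itv/=.
  by move=> [/andP[-> zc] /negP]; rewrite zc andbT -leNgt.
by move=> /andP[-> zb]; rewrite (le_trans zb bc); split=> //; rewrite ltNge zb.
Qed.

End DistInt.

(** * Continuity on subsets *)

Section Continuity.
Variable R : realType.
Implicit Types (f g : R -> R) (A B : set R).

Lemma continuous_comp_within A B f g : {within A, continuous f} ->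
  continuous g -> (forall z, B z -> A (g z)) ->
  {within B, continuous (fun z => f (g z))}.
Proof.
move=> /subspace_continuousP cf cg AB; apply/subspace_continuousP => z Bz P Pfz.
have h : nbhs (g z) [set w | A w -> P (f w)] := cf _ (AB _ Bz) P Pfz.
change (nbhs z [set y | B y -> P (f (g y))]).
have h' : nbhs z [set y | A (g y) -> P (f (g y))] := cg z _ h.
by apply: filterS h' => y hy By; apply: hy; exact: AB.
Qed.

Lemma within_continuousZ A c f : {within A, continuous f} ->
  {within A, continuous (fun z => c * f z)}.
Proof.
move=> /subspace_continuousP cf; apply/subspace_continuousP => z Az.
by apply: cvgM; [exact: cvg_cst|exact: cf].
Qed.

Lemma lipschitz_within_continuous A f M :
  (forall y z, A y -> A z -> `|f y - f z| <= M * `|y - z|) ->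
  {within A, continuous f}.
Proof.
move=> lip; apply/subspace_continuousP => z Az; apply/cvgrPdist_le => e e0.
have M0 : 0 < `|M| + 1 by rewrite ltr_wpDl.
change (\forall y \near z, A y -> `|f z - f y| <= e).
near=> y => Ay; apply: (le_trans (lip _ _ Az Ay)).
have : `|z - y| <= e / (`|M| + 1) by near: y; apply: cvgr_dist_le => //; exact: divr_gt0.
rewrite ler_pdivlMr// => h; apply: le_trans h.
rewrite mulrC ler_wpM2l//; apply: (le_trans (ler_norm _)); lra.
Unshelve. all: by end_near. Qed.

Lemma continuous_comb k s : continuous (@comb R k s).
Proof.
elim: s => [|t s IH].
  rewrite (_ : comb k [::] = cst 0); first exact: cst_continuous.
  by apply/funext => z; rewrite /comb big_nil.
rewrite (_ : comb k _ = fun z => t.1 * Num.max (t.2 - z) 0 ^+ k + comb k s z).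
  move=> z; apply: cvgD; last exact: IH.
  apply: cvgM; first exact: cvg_cst.
  have mx : {for z, continuous ((fun y => t.2 - y) \max cst 0)}.
    apply: continuous_max; last exact: cvg_cst.
    by apply: cvgB; [exact: cvg_cst|exact: cvg_id].
  exact: cvg_comp mx (@exprn_continuous _ k _).
by apply/funext => z; rewrite /comb big_cons.
Qed.

End Continuity.

Lemma continuous_addl (R : realType) (a : R) : continuous (fun y : R => a + y).
Proof. by move=> y; apply: cvgD; [exact: cvg_cst|exact: cvg_id]. Qed.

(** * Stochastic dominance for shifted ramps and their limits *)

Section RampOrder.
Variables (R : realType) (n : nat) (b c a : R) (F G : cumulativeBounded (0 : R) (1 : R)).
Hypotheses (n0 : (0 < n)%N) (c0 : 0 <= c) (a0 : 0 <= a) (acb : a + c <= b).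
Hypotheses (Fs : supported_on 0 c F) (Gs : supported_on 0 c G).
Hypothesis GF : BSD n.+1 0 b G F.

Let shift_itv (z : R) : `[0, c]%classic z -> `[0, b]%classic (a + z).
Proof. by rewrite /= !in_itv/= => zc; move: a0 acb; lra. Qed.

Let within_shift (f : R -> R) : {within `[0, b], continuous f} ->
  {within `[0, c], continuous (fun y : R => f (a + y))}.
Proof. by move=> cf; exact: (continuous_comp_within cf (@continuous_addl _ a) shift_itv). Qed.

Let ramp_continuous (d : R) : continuous (fun z : R => Num.max (d - z) 0 ^+ n).
Proof.
have h := @continuous_comb R n [:: (1, d)].
rewrite (_ : (fun z : R => _) = comb n [:: (1, d)])//.
by apply/funext => z; rewrite /comb big_seq1 mul1r.
Qed.

Lemma le_dist_int_ramp d : 0 <= d <= b ->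
  dist_int G 0 c (fun y => Num.max (d - (a + y)) 0 ^+ n) <=
  dist_int F 0 c (fun y => Num.max (d - (a + y)) 0 ^+ n).
Proof.
(* If d < a, the ramp vanishes on [0, c]. Otherwise its kink [d - a] lies in [0, b] and BSD applies
   once the integrals are widened to [0, b]. *)
move=> db; have [ad|da] := leP a d; last first.
  have z0 y : 0 <= y <= c -> Num.max (d - (a + y)) 0 ^+ n = 0 :> R.
    move=> yc; rewrite (max_idPr _); first by rewrite expr0n; case: n n0.
    lra.
  by rewrite (eq_dist_int G z0) (eq_dist_int F z0) !dist_int_cst.
have cr : {within `[0, b], continuous (fun z : R => Num.max (d - a - z) 0 ^+ n)}.
  exact/continuous_subspaceT/ramp_continuous.
have cb : c <= b by move: a0 acb; lra.
have e y : 0 <= y <= c ->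
    Num.max (d - (a + y)) 0 ^+ n = Num.max (d - a - y) 0 ^+ n.
  by move=> _; rewrite opprD addrA.
rewrite (eq_dist_int F e) (eq_dist_int G e).
rewrite -(dist_int_widen c0 cb Fs cr) -(dist_int_widen c0 cb Gs cr).
by apply: GF; rewrite in_itv/=; move: a0 db ad; lra.
Qed.

Lemma le_dist_int_comb s : admissible 0 b s ->
  dist_int G 0 c (fun y => comb n s (a + y)) <=
  dist_int F 0 c (fun y => comb n s (a + y)).
Proof.
elim: s => [_|t s IH /andP[/andP[t0 tb] hs]].
  have z0 y : 0 <= y <= c -> @comb R n [::] (a + y) = 0 by rewrite /comb big_nil.
  by rewrite (eq_dist_int G z0) (eq_dist_int F z0) !dist_int_cst.
have e y : 0 <= y <= c -> comb n (t :: s) (a + y) =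
    t.1 * Num.max (t.2 - (a + y)) 0 ^+ n + comb n s (a + y).
  by rewrite /comb big_cons.
have cr := within_shift (continuous_subspaceT (@ramp_continuous t.2)).
have cs := within_shift (continuous_subspaceT (@continuous_comb R n s)).
rewrite (eq_dist_int G e) (eq_dist_int F e).
rewrite !(dist_intD _ (@within_continuousZ _ _ t.1 _ cr) cs) !(dist_intZ _ _ cr).
exact: lerD (ler_wpM2l t0 (le_dist_int_ramp tb)) (IH hs).
Qed.

(** Both measures have mass 1, so a uniform error e/2 costs at most e/2 under each. *)
Lemma le_dist_int_ramp_cone v : {within `[0, b], continuous v} ->
  ramp_cone n 0 b v ->
  dist_int G 0 c (fun y => v (a + y)) <= dist_int F 0 c (fun y => v (a + y)).
Proof.
move=> cv vcone; apply/ler_addgt0Pl => e e0.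
have e2 : 0 < e / 2 by lra.
have [s hs vs] := vcone _ e2.
have cva := within_shift cv.
have cs := within_shift (continuous_subspaceT (@continuous_comb R n s)).
have ce (d : R) : {within `[0, c], continuous (fun=> d)}.
  exact/continuous_subspaceT/cst_continuous.
have bnd y : 0 <= y <= c -> `|v (a + y) - comb n s (a + y)| <= e / 2.
  by move=> yc; apply: vs; move: a0 acb; lra.
have hG : dist_int G 0 c (fun y => v (a + y)) <=
    e / 2 + dist_int G 0 c (fun y => comb n s (a + y)).
  rewrite -{1}(dist_int_cst (e / 2) c0 Gs) -dist_intD//.
  apply: le_dist_int => //; first exact: within_continuousD.
  by move=> y /bnd; rewrite ler_norml; lra.
have hF : dist_int F 0 c (fun y => comb n s (a + y)) <=
    e / 2 + dist_int F 0 c (fun y => v (a + y)).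
  rewrite -{1}(dist_int_cst (e / 2) c0 Fs) -dist_intD//.
  apply: le_dist_int => //; first exact: within_continuousD.
  by move=> y /bnd; rewrite ler_norml; lra.
rewrite (splitr e) -addrA; apply: (le_trans hG); rewrite lerD2l.
exact: le_trans (le_dist_int_comb hs) hF.
Qed.

End RampOrder.

(** * The savings problem *)

Section FutureUtility.
Variables (R : realType) (x r ybar : R) (u p : R -> R).
Implicit Types F G : cumulativeBounded (0 : R) (1 : R).
Let b := r * x + ybar.
Hypotheses (r0 : 0 < r) (y0 : 0 < ybar).
Hypothesis cu : {within `[0, b], continuous u}.
Hypothesis cp : {within `[0, b], continuous p}.
Hypothesis up : subgrad 0 b (fun z => - u z) p.

Let shift_bounds s y : 0 <= s <= x -> 0 <= y <= ybar -> 0 <= r * s + y <= b.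
Proof.
move=> /andP[s0 sx] yy; rewrite /b.
have h1 : 0 <= r * s by rewrite mulr_ge0// ltW.
have h2 : r * s <= r * x by rewrite ler_pM2l.
lra.
Qed.

Let within_shift s (f : R -> R) : 0 <= s <= x -> {within `[0, b], continuous f} ->
  {within `[0, ybar], continuous (fun y : R => f (r * s + y))}.
Proof.
move=> sx cf; have sh z : `[0, ybar]%classic z -> `[0, b]%classic (r * s + z).
  by rewrite /= !in_itv/=; exact: shift_bounds.
exact: (continuous_comp_within cf (@continuous_addl _ (r * s)) sh).
Qed.

Let W F s := dist_int F 0 ybar (fun y => u (r * s + y)).

Let cstc (d : R) : {within `[0, ybar], continuous (fun=> d)}.
Proof. exact/continuous_subspaceT/cst_continuous. Qed.

Lemma future_utility_ge F s t : 0 <= s -> s <= t -> t <= x ->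
  r * (t - s) * dist_int F 0 ybar (fun y => p (r * t + y)) <= W F t - W F s.
Proof.
move=> s0 st tx; have sI : 0 <= s <= x by rewrite s0 (le_trans st).
have tI : 0 <= t <= x by rewrite tx (le_trans s0).
have cus := within_shift sI cu; have cut := within_shift tI cu.
have cpt := within_shift tI cp.
rewrite lerBrDl /W -(dist_intZ _ _ cpt) -(dist_intD _ cus (@within_continuousZ _ _ _ _ cpt)).
apply: le_dist_int => //; first exact: within_continuousD cus (@within_continuousZ _ _ _ _ cpt).
move=> y yy; have := up (shift_bounds tI yy) (shift_bounds sI yy); lra.
Qed.

(** The tangent at [r * s + y] bounds the increment from above; the Lipschitz bound moves [p] to
    [r * t + y], the point used in [future_utility_ge], so that the two bounds can be compared under
    different distributions. *)
Lemma future_utility_le F s t L : 0 <= s -> s <= t -> t <= x ->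
  supported_on 0 ybar F ->
  (forall y z, 0 <= y -> y <= z -> z <= b -> p y - p z <= L * (z - y)) ->
  W F t - W F s <=
  r * (t - s) * (dist_int F 0 ybar (fun y => p (r * t + y)) + L * (r * (t - s))).
Proof.
move=> s0 st tx Fs lip; have sI : 0 <= s <= x by rewrite s0 (le_trans st).
have tI : 0 <= t <= x by rewrite tx (le_trans s0).
have cus := within_shift sI cu; have cut := within_shift tI cu.
have cpt := within_shift tI cp.
set d := r * (t - s).
have d0 : 0 <= d by rewrite mulr_ge0 ?subr_ge0// ltW.
have cpd : {within `[0, ybar], continuous (fun y => p (r * t + y) + L * d)}.
  exact: within_continuousD cpt (@cstc (L * d)).
rewrite lerBlDl /W -[X in _ + d * (_ + X)](@dist_int_cst _ F ybar (L * d) (ltW y0) Fs).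
rewrite -(dist_intD _ cpt (@cstc _)) -(dist_intZ _ _ cpd).
rewrite -(dist_intD _ cus (@within_continuousZ _ _ _ _ cpd)).
apply: le_dist_int => //; first exact: within_continuousD cus (@within_continuousZ _ _ _ _ cpd).
move=> y yy; have /andP[sy0 syb] := shift_bounds sI yy.
have /andP[ty0 tyb] := shift_bounds tI yy.
have dE : d = r * t + y - (r * s + y) by rewrite /d; ring.
have sty : r * s + y <= r * t + y by rewrite -subr_ge0 -dE.
have /= := up (shift_bounds sI yy) (shift_bounds tI yy).
have := lip _ _ sy0 sty tyb; rewrite -dE => /(ler_wpM2l d0).
rewrite -(opprB (r * t + y)) -dE; lra.
Qed.


Lemma future_utility_increasing_differences F G n q s t : (0 < n)%N ->
  supported_on 0 ybar F -> supported_on 0 ybar G -> BSD n.+1 0 b G F ->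
  subgrad 0 b p q -> ramp_cone n 0 b (fun z => p z - p b) ->
  0 <= s -> s <= t -> t <= x ->
  W G t - W G s <= W F t - W F s.
Proof.
move=> n0 Fs Gs GF pq pcone s0 st tx.
(* [q] is nonincreasing, so [q 0] is a Lipschitz constant. *)
have lip y z : 0 <= y -> y <= z -> z <= b -> p y - p z <= q 0 * (z - y).
  move=> y0' yz zb; have := pq y z ltac:(lra) ltac:(lra).
  have : q y <= q 0 by apply: (subgrad_nincr pq); lra.
  rewrite -subr_ge0 => /mulr_ge0 /(_ _) h.
  have := h (z - y); rewrite subr_ge0 => /(_ yz); lra.
have cpb : {within `[0, b], continuous (fun z => p z - p b)}.
  apply: (within_continuousD cp); exact/continuous_subspaceT/cst_continuous.
suff : W F s - W G s <= W F t - W G t by move: (W F s) (W F t) (W G s) (W G t) => *; lra.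
(* The Lipschitz correction on a step is [q 0 * (r * (t' - s')) ^+ 2], the error produced by the
   linear function [r ^+ 2 * q 0 * z]. *)
apply: (@almost_ndecr _ s t (fun z => W F z - W G z) (fun z => r ^+ 2 * q 0 * z) st) => s' t' ss st' tt.
have s'0 := le_trans s0 ss; have t'x := le_trans tt tx.
have hF := future_utility_ge F s'0 st' t'x.
have hG := future_utility_le s'0 st' t'x Gs lip.
have t'I : 0 <= t' <= x by rewrite t'x (le_trans s'0).
have cpt := within_shift t'I cp.
(* The cone contains [p - p b]; the constant [p b] has the same integral under F and G. *)
have PGF : dist_int G 0 ybar (fun y => p (r * t' + y)) <=
    dist_int F 0 ybar (fun y => p (r * t' + y)).
  have /andP[rt'0 _] := shift_bounds t'I (introT andP (conj (lexx 0) (ltW y0))).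
  have /andP[_ rt'b] := shift_bounds t'I (introT andP (conj (ltW y0) (lexx ybar))).
  rewrite addr0 in rt'0.
  have := le_dist_int_ramp_cone n0 (ltW y0) rt'0 rt'b Fs Gs GF cpb pcone.
  rewrite !(dist_intD _ cpt (@cstc (- p b))).
  rewrite (@dist_int_cst _ G _ (- p b) (ltW y0) Gs).
  by rewrite (@dist_int_cst _ F _ (- p b) (ltW y0) Fs) lerD2r.
have d0 : 0 <= r * (t' - s') by rewrite mulr_ge0 ?subr_ge0// ltW.
have := ler_wpM2l d0 PGF; move: hF hG.
move: (W F s') (W F t') (W G s') (W G t') (dist_int F _ _ _) (dist_int G _ _ _).
by move=> ? ? ? ? ? ?; lra.
Qed.

(** The tangents of [u] at [r * m + y], taken towards both sides, have opposite linear terms, which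
    cancel. *)
Lemma future_utility_midpoint F s t m :
  0 <= s <= x -> 0 <= t <= x -> 0 <= m <= x -> m = (s + t) / 2 ->
  W F s + W F t <= 2 * W F m.
Proof.
move=> sI tI mI mE.
have cus := within_shift sI cu; have cut := within_shift tI cu.
have cum := within_shift mI cu.
rewrite /W -(dist_intD _ cus cut) -(dist_intZ _ _ cum).
apply: le_dist_int; first exact: within_continuousD cus cut.
  exact: (@within_continuousZ _ _ _ _ cum).
move=> y yy; have sy := shift_bounds sI yy; have ty := shift_bounds tI yy.
have my := shift_bounds mI yy.
have := up my sy; have := up my ty; rewrite mE /=.
set h := p _; lra.
Qed.

Lemma future_utility_continuous F : supported_on 0 ybar F ->
  {within `[0, x], continuous (W F)}.
Proof.
(* By monotonicity [p] lies between [p b] and [p 0], so [M] bounds its absolute value on [0, b]. *)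
move=> Fs; set M := `|p 0| + `|p b|.
have close s t : 0 <= s <= x -> 0 <= t <= x -> s <= t ->
    `|W F s - W F t| <= M * r * `|s - t|.
  move=> sI tI st.
  have cus := within_shift sI cu; have cut := within_shift tI cu.
  have b0 : 0 <= b by have := shift_bounds sI (introT andP (conj (lexx 0) (ltW y0))); lra.
  set d := r * (t - s); have d0 : 0 <= d by rewrite mulr_ge0 ?subr_ge0// ltW.
  have -> : M * r * `|s - t| = M * d.
    by rewrite distrC ger0_norm ?subr_ge0// /d mulrA.
  have bnd y : 0 <= y <= ybar -> `|u (r * s + y) - u (r * t + y)| <= M * d.
    move=> yy; have /andP[sy0 syb] := shift_bounds sI yy.
    have /andP[ty0 tyb] := shift_bounds tI yy.
    have dE : r * t + y - (r * s + y) = d by rewrite /d; ring.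
    have h1 := up (shift_bounds sI yy) (shift_bounds tI yy).
    have h2 := up (shift_bounds tI yy) (shift_bounds sI yy).
    have ps : p (r * s + y) <= p 0 by exact: (subgrad_nincr up).
    have pt : p b <= p (r * t + y) by exact: (subgrad_nincr up).
    have pM : p 0 <= M by rewrite (le_trans (ler_norm _))// lerDl.
    have pM' : - M <= p b by rewrite lerNl (le_trans (ler_norm _))// normrN lerDr.
    have := ler_wpM2r d0 (le_trans ps pM); have := ler_wpM2r d0 (le_trans pM' pt).
    move: h1 h2; rewrite dE -(opprB (r * t + y)) dE ler_norml /=.
    move: (p _) (p _) (u _) (u _) => ? ? ? ?; lra.
  rewrite ler_norml lerNl opprB !lerBlDr /W.
  rewrite -[X in _ <= X + _](@dist_int_cst _ F _ (M * d) (ltW y0) Fs).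
  rewrite -(dist_intD _ (@cstc _) cus).
  rewrite -[X in _ && (_ <= X + _)](@dist_int_cst _ F _ (M * d) (ltW y0) Fs).
  rewrite -(dist_intD _ (@cstc _) cut).
  apply/andP; split; apply: le_dist_int => //.
  - exact: within_continuousD (@cstc _) cus.
  - by move=> y /bnd; rewrite ler_norml; lra.
  - exact: within_continuousD (@cstc _) cut.
  - by move=> y /bnd; rewrite ler_norml; lra.
apply: (@lipschitz_within_continuous _ _ _ (M * r)) => s t; rewrite /= !in_itv/= => sI tI.
have [st|/ltW ts] := leP s t; first exact: close.
by rewrite distrC (distrC s); exact: close.
Qed.

End FutureUtility.

(** * Signed derivatives of marginal utility *)

Section SignedDerivatives.
Variables (R : realType) (n : nat) (b : R) (h : R -> R).
Hypotheses (n0 : (0 < n)%N) (b0 : 0 < b).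
Hypotheses (hU : U_class n 0 b h) (hAP : AP_class n 0 b h).

Definition signed_deriv j z : R := (-1) ^+ j.+1 * deriv_in_n `[0, b] j h z.
Local Notation p := signed_deriv.

Let derivable_h j z : (j < n.+1)%N -> 0 <= z <= b ->
  derivable_in `[0, b] (deriv_in_n `[0, b] j h) z.
Proof. by move=> jn zb; apply: hU.1.1 => //; rewrite /= in_itv. Qed.

Lemma signed_deriv_ge0 j z : (0 < j <= n.+1)%N -> 0 <= z <= b -> 0 <= p j z.
Proof.
move=> jn zb; rewrite /signed_deriv exprS mulN1r mulNr oppr_ge0.
by apply: hU.2 => //; rewrite in_itv.
Qed.

Lemma signed_deriv_nincr j y z : (j <= n)%N -> 0 <= y -> y <= z -> z <= b -> p j z <= p j y.
Proof.
move=> jn; apply: (@derivable_in_nincr _ `[0, b] ((-1) ^+ j.+1) _ 0 b).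
- by [].
- by move=> w wb; exact: derivable_h.
move=> w wb; have := @signed_deriv_ge0 j.+1 w jn wb.
by rewrite /signed_deriv exprS mulN1r mulNr oppr_ge0.
Qed.

(** The range stops at j < n because monotonicity of [p j.+1] uses the sign of [p j.+2]. *)
Lemma subgrad_signed_deriv j : (j < n)%N -> subgrad 0 b (p j) (p j.+1).
Proof.
move=> jn; apply: (@subgrad_derivable_in _ `[0, b] ((-1) ^+ j.+1)).
- by [].
- by move=> z zb; exact: (derivable_h (ltnW jn)).
- by move=> z zb; rewrite /signed_deriv [in RHS]exprS mulN1r mulNr opprK.
- by move=> y z; exact: signed_deriv_nincr.
Qed.

Lemma signed_deriv_flat j : (0 < j < n)%N -> p j b = 0.
Proof.
case: j => // j jn; case: n n0 jn hU hAP signed_deriv_ge0 subgrad_signed_deriv => // m _ jm _ ap ge0 sub.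
(* With n = m + 1 the AP condition is the last hypothesis for the family shifted by one. *)
apply: (@subgrad_flat_end _ 0 b (fun j => p j.+1) m b0) => // [i im|i z im zb|z zb].
- exact: sub.
- by apply: ge0 => //; exact: leqW.
have [_ _] := ap.2 z ltac:(by rewrite in_itv).
rewrite /signed_deriv !expr2 !exprS expr0 -natr1 addrK.
move: (deriv_in_n _ _ _ _) (deriv_in_n _ _ _ _) => d1 d2. lra.
Qed.

Lemma ramp_cone_signed_deriv : ramp_cone n 0 b (fun z => p 0%N z - p 0%N b).
Proof.
apply: ramp_cone_family => //; [exact: subgrad_signed_deriv|exact: signed_deriv_flat|].
by apply: signed_deriv_ge0; rewrite ?n0 ?leqnSn//= lexx ltW.
Qed.

Lemma continuous_signed_deriv0 : {within `[0, b], continuous (p 0%N)}.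
Proof.
apply: (@within_continuousZ _ `[0, b] ((-1) ^+ 1) h).
by apply: derivable_in_continuous => z; rewrite /= in_itv/=; exact: (@derivable_h 0).
Qed.

End SignedDerivatives.

(** * Comparison of the optimal savings *)

Theorem proposition4 (R : realType) (n : nat) (x r ybar : R)
    (I : set R) (u : R -> R)
    (F G : cumulativeBounded (0 : R) (1 : R)) :
  (0 < n)%N -> 0 <= x -> 0 < r -> 0 < ybar ->
  is_interval I ->
  `[0, x] `|` `[0, r * x + ybar] `<=` I ->
  strictly_increasing_on I u ->
  strictly_concave_on I u ->
  Ck_in 1 I u ->
  (U_class n 0 (r * x + ybar) `&` AP_class n 0 (r * x + ybar))
    (fun z => - deriv_in_n I 1 u z) ->
  supported_on 0 ybar F -> supported_on 0 ybar G ->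
  BSD n.+1 0 (r * x + ybar) G F ->
  opt_savings u x r ybar F >= opt_savings u x r ybar G.
Proof.
move=> n0 x0 r0 y0 _ xbI _ uconc [du _] [hU hAP] Fs Gs GF.
set b := r * x + ybar in xbI hU hAP GF *.
have b0 : 0 < b by rewrite ltr_wpDl// mulr_ge0// ltW.
have bI : `[0, b] `<=` I by move=> z zb; apply: xbI; right.
have xI : `[0, x] `<=` I by move=> z zx; apply: xbI; left.
have {}du z : I z -> derivable_in I u z by exact: (du 0%N).
have cuI : {within I, continuous u} by exact: derivable_in_continuous.
have cu : {within `[0, b], continuous u} by exact: continuous_subspaceW bI cuI.
set h := fun z => _ in hU hAP.
pose p := signed_deriv b h.
have cp : {within `[0, b], continuous (p 0%N)} := continuous_signed_deriv0 hU.
have up : subgrad 0 b (fun z => - u z) (p 0%N).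
  have -> : (fun z => - u z) = (fun z => -1 * u z) by apply/funext => z; rewrite mulN1r.
  apply: (@subgrad_derivable_in _ I (-1) u (p 0%N) 0 b bI) => [z zb|z zb|y z].
  - by apply/du/bI; rewrite /= in_itv.
  - by rewrite /p /signed_deriv expr1 mulN1r mulN1r opprK.
  - exact: (signed_deriv_nincr hU).
have pcone := ramp_cone_signed_deriv n0 b0 hU hAP.
pose EU K s := exp_utility u x r ybar K s.
(* Continuity on the compact [0, x] makes the argmax nonempty, so [xget] returns a maximizer and not
   its default 0. *)
have opt K : supported_on 0 ybar K -> let s := opt_savings u x r ybar K in
    0 <= s <= x /\ forall t, 0 <= t <= x -> EU K t <= EU K s.
  move=> Ks; have cEU : {within `[0, x], continuous (EU K)}.
    apply: within_continuousD; last exact: (future_utility_continuous r0 y0 cu up Ks).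
    apply: (continuous_comp_within cuI) => [z|z].
      by apply: cvgB; [exact: cvg_cst|exact: cvg_id].
    by rewrite /= in_itv/= => zx; apply: xI; rewrite /= in_itv/=; lra.
  have [c cx cmax] := EVT_max x0 cEU.
  have Kc : argmax `[0, x] (EU K) c by split=> // t tx; exact: cmax.
  have [sx smax] := xgetPex 0 (ex_intro _ c Kc).
  split=> [|t tx]; first by move: sx; rewrite /= in_itv.
  by apply: smax; rewrite /= in_itv.
have [] := opt F Fs; have [] := opt G Gs; rewrite {opt}.
move: (opt_savings _ _ _ _ F) (opt_savings _ _ _ _ G) => sF sG sGx optG sFx optF.
rewrite leNgt; apply/negP => FG.
(* If sF < sG, increasing differences and optimality of sG under G make sG as good as sF under F;
   strict concavity of [u] then makes the midpoint strictly better under F, a contradiction. *)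
pose m := (sF + sG) / 2.
have mx : 0 <= m <= x by rewrite /m; lra.
have toI s : 0 <= s <= x -> I (x - s).
  by move=> sx; apply: xI; rewrite /= in_itv/=; lra.
have conc := uconc (x - sF) (x - sG) (1 / 2) (toI _ sFx) (toI _ sGx) ltac:(lra) ltac:(lra).
have mE : 1 / 2 * (x - sF) + (1 - 1 / 2) * (x - sG) = x - m by rewrite /m; lra.
rewrite mE in conc.
have := optF _ mx; have := optG _ sFx; have := optF _ sGx.
have mid := future_utility_midpoint r0 cu up F sFx sGx mx erefl.
have diff := future_utility_increasing_differences r0 y0 cu cp up n0 Fs Gs GF
  (subgrad_signed_deriv hU n0) pcone (proj1 (andP sFx)) (ltW FG) (proj2 (andP sGx)).
rewrite /EU /exp_utility; move: diff mid conc; clear.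
move: (dist_int F _ _ (fun y => u (r * sF + y))) (dist_int F _ _ (fun y => u (r * sG + y))) => F1 F2.
move: (dist_int G _ _ (fun y => u (r * sF + y))) (dist_int G _ _ (fun y => u (r * sG + y))) => G1 G2.
move: (dist_int F _ _ _) => F3; lra.
Qed.
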